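(* Let $(R, \mathfrak{m})$ be a square zero extension of $\mathbb{Z}/2\mathbb{Z}$. (1) $R$ has property $( * )$ if and only if $R$ is Noetherian, if and only if $R$ is finite. In this case $|R| = 2^{n+1}$, where $n := \mu_R(\mathfrak{m})$ denotes the minimal number of generators of the ideal $\mathfrak{m}$. (2) $R$ has property $( ** )$ if and only if $\operatorname{char} R = 2$ or $R$ is Noetherian.
   Context: All rings are commutative with $1 \neq 0$ (in particular nonzero), and ring maps take $1$ to $1$. A ring $R$ is a square zero extension of $\mathbb{Z}/2\mathbb{Z}$ if there exists an ideal $\mathfrak{m}$ of $R$ such that $|R/\mathfrak{m}| = 2$ (i.e. $R/\mathfrak{m} \cong \mathbb{Z}/2\mathbb{Z}$) and $\mathfrak{m}^2 = 0$; one writes $(R, \mathfrak{m})$ for $R$ with this ideal. A ring $R$ has property $( * )$ if there exist a Noetherian ring $S$ and a flat ring map $R \to S$ (i.e. $S$ is flat as an $R$-module). A ring $R$ has property $( ** )$ if there exist a Noetherian ring $S$ and a flat ring map $S \to R$ (i.e. $R$ is flat as an $S$-module). $\operatorname{char} R$ denotes the characteristic of $R$. *)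

(* Defs.v *)
From HB Require Import structures.
From mathcomp Require Import all_boot all_algebra.
From mathcomp Require Import all_classical.

Set Implicit Arguments.
Unset Strict Implicit.
Unset Printing Implicit Defensive.

Import GRing.Theory.
Local Open Scope classical_set_scope.
Local Open Scope card_scope.
Local Open Scope ring_scope.

Section Ideals.
Variable R : comNzRingType.
Implicit Types I J : set R.

(* Unlike MathComp's [idealr_closed], this allows the unit ideal. *)
Definition is_ideal I : Prop :=
  [/\ I 0, forall x y, I x -> I y -> I (x + y) & forall a x, I x -> I (a * x)].

Definition ideal_gen n (g : 'I_n -> R) : set R :=
  [set x | exists c : 'I_n -> R, x = \sum_i c i * g i].

Definition noetherian : Prop :=
  forall I, is_ideal I -> exists n (g : 'I_n -> R), I = ideal_gen g.

Definition ideal_mul I J : set R :=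
  [set z | exists n (a b : 'I_n -> R),
     (forall i, I (a i) /\ J (b i)) /\ z = \sum_i a i * b i].

(* The underlying set of R/I, as a set of subsets of R. *)
Definition cosets I : set (set R) := range (fun x => [set y | I (y - x)]).

(* [mu_ideal I n] says that the minimal number of generators of I exists (I is
   finitely generated) and equals n. *)
Definition mu_ideal I (n : nat) : Prop :=
  (exists g : 'I_n -> R, I = ideal_gen g) /\
  (forall k (g : 'I_k -> R), I = ideal_gen g -> (n <= k)%N).

Definition square_zero_ext_F2 (m : set R) : Prop :=
  [/\ is_ideal m, cosets m #= `I_2 & ideal_mul m m = [set 0]].

End Ideals.

Arguments noetherian R : clear implicits.

(* The tensor product M (x) N over R is the quotient of the free commutative
   monoid on M * N by the congruence generated by the bilinearity relations; a
   sequence [:: (x1, y1); ...; (xk, yk)] stands for the formal sum of the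
   xi (x) yi. The relations [tens_0l] and [tens_0r] make this quotient a group,
   with opposite induced by x (x) y |-> (- x) (x) y. *)
Section Tensor.
Variables (R : comNzRingType) (M N : lmodType R).
Local Notation formal_sum := (seq (M * N)).

Inductive tens_rel : formal_sum -> formal_sum -> Prop :=
| tens_refl s : tens_rel s s
| tens_sym s t : tens_rel s t -> tens_rel t s
| tens_trans s t u : tens_rel s t -> tens_rel t u -> tens_rel s u
| tens_cat s s' t t' :
    tens_rel s s' -> tens_rel t t' -> tens_rel (s ++ t) (s' ++ t')
| tens_catC s t : tens_rel (s ++ t) (t ++ s)
| tens_0l y : tens_rel [:: (0, y)] [::]
| tens_0r x : tens_rel [:: (x, 0)] [::]
| tens_Dl x x' y : tens_rel [:: (x + x', y)] [:: (x, y); (x', y)]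
| tens_Dr x y y' : tens_rel [:: (x, y + y')] [:: (x, y); (x, y')]
| tens_Z (a : R) x y : tens_rel [:: (a *: x, y)] [:: (x, a *: y)].

Definition tens_relb : rel formal_sum := fun s t => `[< tens_rel s t >].

Lemma tens_relb_refl : reflexive tens_relb.
Proof. by move=> s; apply/asboolP/tens_refl. Qed.

Lemma tens_relb_sym : symmetric tens_relb.
Proof. by move=> s t; apply/asboolP/asboolP => /tens_sym. Qed.

Lemma tens_relb_trans : transitive tens_relb.
Proof.
move=> t s u /asboolP st /asboolP tu; apply/asboolP; exact: tens_trans st tu.
Qed.

Canonical tens_equiv :=
  EquivRel tens_relb tens_relb_refl tens_relb_sym tens_relb_trans.

Definition tensor := {eq_quot tens_equiv}%qT.
HB.instance Definition _ := Choice.on tensor.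

Definition tens_class (s : formal_sum) : tensor := (\pi_tensor s)%qT.

Lemma tens_classP s t : tens_class s = tens_class t <-> tens_rel s t.
Proof.
rewrite /tens_class; split => [/eqquotP /asboolP //|st].
by apply/eqquotP/asboolP.
Qed.

Definition tens_repr (u : tensor) : formal_sum := (repr u)%qT.

Lemma tens_reprK u : tens_class (tens_repr u) = u.
Proof. exact: reprK. Qed.

Lemma tens_repr_rel s : tens_rel (tens_repr (tens_class s)) s.
Proof. by apply/tens_classP; rewrite tens_reprK. Qed.

Definition fs_scale (a : R) (s : formal_sum) : formal_sum :=
  [seq (a *: p.1, p.2) | p <- s].

Lemma fs_scale_rel a s t : tens_rel s t -> tens_rel (fs_scale a s) (fs_scale a t).
Proof.
elim=> {s t} /=.
- by move=> s; apply: tens_refl.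
- by move=> s t _; apply: tens_sym.
- by move=> s t u _ h _; apply: tens_trans h.
- by move=> s s' t t' _ h _ h'; rewrite /fs_scale !map_cat; apply: tens_cat.
- by move=> s t; rewrite /fs_scale !map_cat; apply: tens_catC.
- by move=> y; rewrite scaler0; apply: tens_0l.
- by move=> x; apply: tens_0r.
- by move=> x x' y; rewrite scalerDr; apply: tens_Dl.
- by move=> x y y'; apply: tens_Dr.
- by move=> b x y; rewrite scalerA mulrC -scalerA; apply: tens_Z.
Qed.

Definition tens_add (u v : tensor) := tens_class (tens_repr u ++ tens_repr v).
Definition tens_scale (a : R) (u : tensor) := tens_class (fs_scale a (tens_repr u)).
Definition tens_opp (u : tensor) := tens_scale (-1) u.
Definition tens_zero : tensor := tens_class [::].

Lemma tens_addE s t : tens_add (tens_class s) (tens_class t) = tens_class (s ++ t).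
Proof. by apply/tens_classP/tens_cat; apply: tens_repr_rel. Qed.

Lemma tens_scaleE a s : tens_scale a (tens_class s) = tens_class (fs_scale a s).
Proof. by apply/tens_classP/fs_scale_rel/tens_repr_rel. Qed.

Lemma tens_addA : associative tens_add.
Proof.
move=> u v w; rewrite -(tens_reprK u) -(tens_reprK v) -(tens_reprK w).
by rewrite !tens_addE catA.
Qed.

Lemma tens_addC : commutative tens_add.
Proof. by move=> u v; apply/tens_classP/tens_catC. Qed.

Lemma tens_add0 : left_id tens_zero tens_add.
Proof. by move=> u; rewrite -(tens_reprK u) tens_addE. Qed.

(* (a s) + (b s) ~ (a + b) s at the level of formal sums. *)
Lemma fs_scaleDl a b s :
  tens_rel (fs_scale a s ++ fs_scale b s) (fs_scale (a + b) s).
Proof.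
elim: s => [|[x y] s IH] /=; first exact: tens_refl.
rewrite scalerDl.
apply: (@tens_trans _ ([:: (a *: x, y); (b *: x, y)] ++
                       (fs_scale a s ++ fs_scale b s))).
  rewrite -cat1s -[X in tens_rel _ X]/([:: _] ++ ([:: _] ++ (_ ++ _))).
  apply: tens_cat; first exact: tens_refl.
  rewrite -cat1s !catA; apply: tens_cat; last exact: tens_refl.
  exact: tens_catC.
rewrite -[X in tens_rel _ X]cat1s; apply: tens_cat IH.
exact/tens_sym/tens_Dl.
Qed.

Lemma tens_addN : left_inverse tens_zero tens_opp tens_add.
Proof.
move=> u; rewrite -(tens_reprK u) /tens_opp tens_scaleE tens_addE.
apply/tens_classP; move: (tens_repr u) => s.
have -> : fs_scale (-1) s ++ s = fs_scale (-1) s ++ fs_scale 1 s.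
  congr (_ ++ _); rewrite /fs_scale -[LHS]map_id.
  by apply: eq_map => -[x y]; rewrite scale1r.
apply: tens_trans (fs_scaleDl _ _ _) _; rewrite addNr.
elim: s => [|[x y] s IH] /=; first exact: tens_refl.
rewrite scale0r -cat1s; exact: tens_cat (tens_0l y) IH.
Qed.

HB.instance Definition _ :=
  GRing.isZmodule.Build tensor tens_addA tens_addC tens_add0 tens_addN.

Lemma tens_scaleA a b u : tens_scale a (tens_scale b u) = tens_scale (a * b) u.
Proof.
rewrite -(tens_reprK u) !tens_scaleE /fs_scale -map_comp.
by congr tens_class; apply: eq_map => -[x y] /=; rewrite scalerA.
Qed.

Lemma tens_scale1 : left_id 1 tens_scale.
Proof.
move=> u; rewrite -(tens_reprK u) tens_scaleE; congr tens_class.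
by rewrite /fs_scale -[RHS]map_id; apply: eq_map => -[x y]; rewrite scale1r.
Qed.

Lemma tens_scaleDr : right_distributive tens_scale +%R.
Proof.
move=> a u v; rewrite -(tens_reprK u) -(tens_reprK v).
by rewrite [in LHS]/+%R [in RHS]/+%R /= !(tens_addE, tens_scaleE) /fs_scale map_cat.
Qed.

Lemma tens_scaleDl u : {morph tens_scale^~ u : a b / a + b}.
Proof.
move=> a b; rewrite -(tens_reprK u) !tens_scaleE [RHS]tens_addE.
exact/tens_classP/tens_sym/fs_scaleDl.
Qed.

HB.instance Definition _ := GRing.Zmodule_isLmodule.Build R tensor
  tens_scaleA tens_scale1 tens_scaleDr tens_scaleDl.

Definition tens (x : M) (y : N) : tensor := tens_class [:: (x, y)].

Lemma tens_classE s : tens_class s = \sum_(p <- s) tens p.1 p.2.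
Proof.
elim: s => [|[x y] s IH]; first by rewrite big_nil.
by rewrite big_cons -IH [RHS]tens_addE.
Qed.

Lemma tensor_sum (u : tensor) : exists s : formal_sum, u = \sum_(p <- s) tens p.1 p.2.
Proof. by exists (tens_repr u); rewrite -tens_classE tens_reprK. Qed.

Lemma tensDl x x' y : tens (x + x') y = tens x y + tens x' y.
Proof. by rewrite [RHS]tens_addE; apply/tens_classP/tens_Dl. Qed.

Lemma tensDr x y y' : tens x (y + y') = tens x y + tens x y'.
Proof. by rewrite [RHS]tens_addE; apply/tens_classP/tens_Dr. Qed.

Lemma tensZl a x y : tens (a *: x) y = a *: tens x y.
Proof. by rewrite [RHS]tens_scaleE. Qed.

Lemma tensZr a x y : tens x (a *: y) = a *: tens x y.
Proof. by rewrite -tensZl; apply/tens_classP/tens_sym/tens_Z. Qed.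

End Tensor.

Section UniversalProperty.
Variables (R : comNzRingType) (M N P : lmodType R).

Definition bilinear (b : M -> N -> P) : Prop :=
  [/\ forall x x' y, b (x + x') y = b x y + b x' y,
      forall x y y', b x (y + y') = b x y + b x y',
      forall a x y, b (a *: x) y = a *: b x y
    & forall a x y, b x (a *: y) = a *: b x y].

Definition tens_lift (b : M -> N -> P) (u : tensor M N) : P :=
  \sum_(p <- tens_repr u) b p.1 p.2.

Variables (b : M -> N -> P) (bilin : bilinear b).

Lemma tens_lift_rel s t : tens_rel s t ->
  \sum_(p <- s) b p.1 p.2 = \sum_(p <- t) b p.1 p.2.
Proof.
have [bDl bDr bZl bZr] := bilin.
elim=> {s t} //=.
- by move=> s t u _ -> _ ->.
- by move=> s s' t t' _ h _ h'; rewrite !big_cat h h'.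
- by move=> s t; rewrite !big_cat /= addrC.
- by move=> y; rewrite big_seq1 big_nil -(scale0r 0) bZl scale0r.
- by move=> x; rewrite big_seq1 big_nil -(scale0r 0) bZr scale0r.
- by move=> x x' y; rewrite !big_cons big_nil /= !addr0 bDl.
- by move=> x y y'; rewrite !big_cons big_nil /= !addr0 bDr.
- by move=> a x y; rewrite !big_seq1 bZl bZr.
Qed.

Lemma tens_lift_class s : tens_lift b (tens_class s) = \sum_(p <- s) b p.1 p.2.
Proof. exact/tens_lift_rel/tens_repr_rel. Qed.

Lemma tens_liftE x y : tens_lift b (tens x y) = b x y.
Proof. by rewrite tens_lift_class big_seq1. Qed.

Lemma tens_lift_is_linear : linear (tens_lift b).
Proof.
have [_ _ bZl _] := bilin.
move=> a u v; rewrite -(tens_reprK u) -(tens_reprK v).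
rewrite [X in tens_lift b (X + _)]tens_scaleE [X in tens_lift b X]tens_addE.
rewrite !tens_lift_class big_cat /= big_map scaler_sumr; congr (_ + _).
by apply: eq_bigr => p _; rewrite bZl.
Qed.

Lemma tens_lift_unique (h : {linear tensor M N -> P}) :
  (forall x y, h (tens x y) = b x y) -> h =1 tens_lift b.
Proof.
move=> hb u; rewrite -(tens_reprK u) tens_lift_class tens_classE linear_sum.
by apply: eq_bigr => p _; rewrite hb.
Qed.

End UniversalProperty.

Section Flat.
Variable R : comNzRingType.

(* The map u (x) id_N. *)
Definition tensor_map (M M' N : lmodType R) (u : {linear M -> M'}) :
    tensor M N -> tensor M' N :=
  tens_lift (fun x y => tens (u x) y).

Lemma tensor_map_bilinear (M M' N : lmodType R) (u : {linear M -> M'}) :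
  bilinear (fun (x : M) (y : N) => tens (u x) y).
Proof.
by split=> *; rewrite ?linearD ?linearZ ?(tensDl, tensDr, tensZl, tensZr).
Qed.

Lemma tensor_mapE (M M' N : lmodType R) (u : {linear M -> M'}) x (y : N) :
  tensor_map u (tens x y) = tens (u x) y.
Proof. exact/tens_liftE/tensor_map_bilinear. Qed.

Definition flat (N : lmodType R) : Prop :=
  forall (M M' : lmodType R) (u : {linear M -> M'}),
    injective u -> injective (tensor_map (N := N) u).

End Flat.

(* S regarded as an R-module along f : R -> S. *)
Section RestrictScalars.
Variables R S : comNzRingType.

Definition restrict_scalars of {rmorphism R -> S} : Type := S.

Variable f : {rmorphism R -> S}.
HB.instance Definition _ := GRing.Zmodule.on (restrict_scalars f).

Definition restr_scale (a : R) (x : restrict_scalars f) : restrict_scalars f :=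
  f a * (x : S).

Lemma restr_scaleA a b x :
  restr_scale a (restr_scale b x) = restr_scale (a * b) x.
Proof. by rewrite /restr_scale rmorphM mulrA. Qed.

Lemma restr_scale1 : left_id 1 restr_scale.
Proof. by move=> x; rewrite /restr_scale rmorph1 mul1r. Qed.

Lemma restr_scaleDr : right_distributive restr_scale +%R.
Proof. by move=> a x y; rewrite /restr_scale mulrDr. Qed.

Lemma restr_scaleDl x : {morph restr_scale^~ x : a b / a + b}.
Proof. by move=> a b; rewrite /restr_scale rmorphD mulrDl. Qed.

HB.instance Definition _ := GRing.Zmodule_isLmodule.Build R (restrict_scalars f)
  restr_scaleA restr_scale1 restr_scaleDr restr_scaleDl.

Lemma restr_scaleE (a : R) (x : S) :
  a *: (x : restrict_scalars f) = f a * x :> S.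
Proof. by []. Qed.

End RestrictScalars.

Definition flat_map (R S : comNzRingType) (f : {rmorphism R -> S}) : Prop :=
  flat (restrict_scalars f).

Definition flat_to_noetherian (R : comNzRingType) : Prop :=
  exists (S : comNzRingType) (f : {rmorphism R -> S}),
    noetherian S /\ flat_map f.

Definition flat_over_noetherian (R : comNzRingType) : Prop :=
  exists (S : comNzRingType) (f : {rmorphism S -> R}),
    noetherian S /\ flat_map f.

(* Main.v *)
Require Import Defs.
From HB Require Import structures.
From mathcomp Require Import all_boot all_algebra.
From mathcomp Require Import all_classical.

(** Write k for the residue field R/m, which has two elements. Since m^2 = 0,
    multiplication by r on m depends only on the class of r in k, so m is a
    k-vector space whose subspaces are ideals of R; every r outside m satisfies
    r^2 = 1. If g_1, ..., g_n generate m, every element of R is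
    b + c_1 g_1 + ... + c_n g_n with b and all c_i in {0, 1}
    ([sqz_param_surj]), so that R is finite as soon as m is finitely generated.
    If n is minimal this expression is unique ([sqz_param_inj]), as two
    expressions of the same element would let one drop a generator
    ([drop_generator]). This gives |R| = 2^(n+1).

    Both statements about flatness rest on a single consequence of it,
    [flat_colon]: if N is flat, I is an ideal and y x lies in I N, then x lies
    in (I : y) N. It comes from tensoring the injection R/(I : y) -> R/I,
    multiplication by y, with N.

    If R -> S is flat with S Noetherian, finitely many elements of m suffice to
    generate m S ([noetherian_smul_fg]). Let I be the ideal of R they generate
    and suppose that y is in m but not in I. Then y 1 lies in I S, so 1 lies in
    (I : y) S. The elements outside m are units, hence (I : y) is contained in
    m, and 1 lies in m S, which is absurd because (m S)^2 = 0. So m = I is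
    finitely generated and R is finite.

    If S -> R is flat with S Noetherian and 2 is nonzero in R, let p be the
    preimage of m in S. As 2 lies in m, 2 x = 0 for every x in m, and
    [flat_colon] with I = 0 puts x in Ann_S(2) R. An element of S killing 2
    cannot map to a unit of R, so Ann_S(2) is contained in p. Hence m = p R,
    and m is finitely generated because p is.

    Conversely, the identity of a ring is flat ([flat_idfun]), and a ring of
    characteristic 2 is flat over 'F_2 because all modules over a field are
    ([flat_field]): an injective linear map has a linear retraction, and
    tensoring preserves retractions. *)

Set Implicit Arguments.
Unset Strict Implicit.
Unset Printing Implicit Defensive.

Import GRing.Theory.
Local Open Scope classical_set_scope.
Local Open Scope card_scope.
Local Open Scope ring_scope.

(** * Quotients of modules *)

Definition is_submodule (R : comNzRingType) (M : lmodType R) (K : set M) :=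
  [/\ K 0, forall x y, K x -> K y -> K (x + y) &
      forall (a : R) x, K x -> K (a *: x)].
Arguments is_submodule {R M} K.

Section QuotientModule.
Variables (R : comNzRingType) (M : lmodType R) (K : set M).
Hypothesis subK : is_submodule K.

(** The closure proof is an argument so that the algebraic structure, which
    depends on it, can be inferred from the predicate. *)
Definition submodule_pred of is_submodule K : {pred M} := fun x => `[< K x >].

Lemma submodule_pred_closed : zmod_closed (submodule_pred subK).
Proof.
have [K0 KD KZ] := subK.
split=> [|x y /asboolP Kx /asboolP Ky]; apply/asboolP => //.
by rewrite -scaleN1r; apply: KD => //; apply: KZ.
Qed.
HB.instance Definition _ :=
  GRing.isZmodClosed.Build M (submodule_pred subK) submodule_pred_closed.

Definition quotient_module := Quotient.quot (submodule_pred subK).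
HB.instance Definition _ := GRing.Zmodule.on quotient_module.

Definition quotient_pi (x : M) : quotient_module :=
  (\pi_(Quotient.quot (submodule_pred subK)) x)%qT.
Definition quotient_repr (u : quotient_module) : M :=
  (repr (u : Quotient.quot (submodule_pred subK)))%qT.

Lemma quotient_reprK u : quotient_pi (quotient_repr u) = u.
Proof. exact: reprK. Qed.

Lemma quotient_piP x y : quotient_pi x = quotient_pi y <-> K (x - y).
Proof.
split=> [/eqP|Kxy]; first by rewrite -Quotient.idealrBE => /asboolP.
by apply/eqP; rewrite -Quotient.idealrBE; apply/asboolP.
Qed.

Lemma quotient_piD x y : quotient_pi (x + y) = quotient_pi x + quotient_pi y.
Proof. exact: Quotient.pi_add. Qed.

Definition quotient_scale (a : R) (u : quotient_module) : quotient_module :=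
  quotient_pi (a *: quotient_repr u).

Lemma quotient_scaleE a x :
  quotient_scale a (quotient_pi x) = quotient_pi (a *: x).
Proof.
have [_ _ KZ] := subK.
apply/quotient_piP; rewrite -scalerBr; apply: KZ.
by apply/quotient_piP; rewrite quotient_reprK.
Qed.

Lemma quotient_scaleA a b u :
  quotient_scale a (quotient_scale b u) = quotient_scale (a * b) u.
Proof. by rewrite -[u]quotient_reprK !quotient_scaleE scalerA. Qed.

Lemma quotient_scale1 : left_id 1 quotient_scale.
Proof. by move=> u; rewrite -[u]quotient_reprK quotient_scaleE scale1r. Qed.

Lemma quotient_scaleDr : right_distributive quotient_scale +%R.
Proof.
move=> a u v; rewrite -[u]quotient_reprK -[v]quotient_reprK.
by rewrite -quotient_piD !quotient_scaleE scalerDr quotient_piD.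
Qed.

Lemma quotient_scaleDl u : {morph quotient_scale^~ u : a b / a + b}.
Proof.
move=> a b; rewrite -[u]quotient_reprK !quotient_scaleE.
by rewrite scalerDl quotient_piD.
Qed.

HB.instance Definition _ := GRing.Zmodule_isLmodule.Build R quotient_module
  quotient_scaleA quotient_scale1 quotient_scaleDr quotient_scaleDl.

Lemma quotient_piZ a x : quotient_pi (a *: x) = a *: quotient_pi x.
Proof. by rewrite -quotient_scaleE. Qed.

Lemma quotient_pi0 x : quotient_pi x = 0 <-> K x.
Proof.
have -> : 0 = quotient_pi 0 by have := quotient_piZ 0 0; rewrite !scale0r.
by rewrite quotient_piP subr0.
Qed.

End QuotientModule.

(** * Tensor products and flatness *)

(** Known as A N; as A ranges over arbitrary subsets, generators of an ideal can
    stand for the ideal. *)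
Definition smul (R : comNzRingType) (A : set R) (N : lmodType R) : set N :=
  [set z | exists s : seq (R * N),
     {in s, forall p, A p.1} /\ z = \sum_(p <- s) p.1 *: p.2].
Arguments smul {R} A N.

Section TensorFacts.
Variable R : comNzRingType.

Lemma tens0l (M N : lmodType R) (y : N) : tens (0 : M) y = 0.
Proof. exact/tens_classP/tens_0l. Qed.

Lemma tens0r (M N : lmodType R) (x : M) : tens x (0 : N) = 0.
Proof. exact/tens_classP/tens_0r. Qed.

Lemma tensor_map_linear (M M' N : lmodType R) (u : {linear M -> M'}) :
  linear (tensor_map (N := N) u).
Proof. exact/tens_lift_is_linear/tensor_map_bilinear. Qed.
HB.instance Definition _ (M M' N : lmodType R) (u : {linear M -> M'}) :=
  GRing.isLinear.Build R (tensor M N) (tensor M' N) *:%R (tensor_map u)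
    (tensor_map_linear u).

End TensorFacts.

Section Colon.
Variables (R : comNzRingType) (N : lmodType R).

Lemma smul_submodule (A : set R) : is_submodule (smul A N).
Proof.
split=> [|x y [s [As ->]] [t [At ->]]|a x [s [As ->]]].
- by exists [::]; rewrite big_nil.
- exists (s ++ t); rewrite big_cat; split=> // p.
  by rewrite mem_cat => /orP[/As|/At].
- exists [seq (p.1, a *: p.2) | p <- s]; split=> [_ /mapP[p /As Ap ->] //|].
  rewrite big_map scaler_sumr; apply: eq_bigr => p _ /=.
  by rewrite !scalerA mulrC.
Qed.

Lemma smul_min (A : set R) (K : set N) : is_submodule K ->
  (forall a x, A a -> K (a *: x)) -> smul A N `<=` K.
Proof.
move=> [K0 KD _] AK _ [s [As ->]].
by rewrite big_seq; apply: big_ind => // p /As; exact: AK.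
Qed.

Lemma smul_mem (A : set R) a (x : N) : A a -> smul A N (a *: x).
Proof.
move=> Aa; exists [:: (a, x)]; rewrite big_seq1.
by split=> // p /[1!inE] /eqP->.
Qed.

Lemma smulS (A B : set R) : A `<=` B -> smul A N `<=` smul B N.
Proof.
by move=> AB; apply: (smul_min (smul_submodule B)) => a x /AB; apply: smul_mem.
Qed.

Definition colon (I : set R) (y : R) : set R := [set a | I (a * y)].

Lemma ideal_submodule (I : set R) :
  is_ideal I -> is_submodule (I : set (R^o : lmodType R)).
Proof. by []. Qed.

Lemma colon_ideal (I : set R) y : is_ideal I -> is_ideal (colon I y).
Proof.
move=> [I0 ID IZ]; split=> [|a b Ia Ib|a b Ib]; rewrite /colon /=.
- by rewrite mul0r.
- by rewrite mulrDl; apply: ID.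
- by rewrite -mulrA; apply: IZ.
Qed.

(** Multiplication by [y] induces an injection from R/(I : y) to R/I, which
    remains injective after tensoring with [N]. It sends 1 (x) x to
    1 (x) (y x) = 0, so 1 (x) x = 0 in R/(I : y) (x) N, which maps to
    N/(I : y)N by a (x) n |-> a n. *)
Lemma flat_colon (I : set R) (y : R) (x : N) :
  flat N -> is_ideal I -> smul I N (y *: x) -> smul (colon I y) N x.
Proof.
move=> flatN idI yxI.
have subI := ideal_submodule idI.
have idJ := colon_ideal y idI; have subJ := ideal_submodule idJ.
pose RI := quotient_module subI; pose RJ := quotient_module subJ.
have subJN := smul_submodule (colon I y).
have repJ a : colon I y (quotient_repr (quotient_pi subJ a) - a).
  by apply/(quotient_piP subJ); rewrite quotient_reprK.
pose mul_y (u : RJ) : RI := quotient_pi subI (y *: (quotient_repr u : R^o)).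
have mul_yE a : mul_y (quotient_pi subJ a) = quotient_pi subI (y * a).
  apply/quotient_piP; rewrite /= -[y *: _]/(y * _) -mulrBr mulrC; exact: repJ.
have mul_y_linear : linear mul_y.
  move=> a u v; rewrite -[u]quotient_reprK -[v]quotient_reprK.
  rewrite -quotient_piZ -quotient_piD !mul_yE -quotient_piZ -quotient_piD.
  by congr quotient_pi; rewrite mulrDr mulrCA.
pose mul_y_lin : {linear RJ -> RI} :=
  HB.pack mul_y (GRing.isLinear.Build R RJ RI *:%R mul_y mul_y_linear).
have mul_y_inj : injective mul_y_lin.
  move=> u v; rewrite -[u]quotient_reprK -[v]quotient_reprK /= !mul_yE.
  move/quotient_piP; rewrite -mulrBr mulrC => Iuv.
  exact/quotient_piP.
have : tens (quotient_pi subJ 1) x = 0 :> tensor RJ N.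
  apply: (flatN _ _ _ mul_y_inj).
  have -> : tensor_map mul_y_lin (tens (quotient_pi subJ 1) x) =
            tens (quotient_pi subI 1) (y *: x).
    rewrite tensor_mapE /= mul_yE tensZr -tensZl; congr tens.
    by rewrite -quotient_piZ.
  rewrite linear0.
  have [s [Is ->]] := yxI.
  have tens_sum (t : seq (R * N)) :
      tens (quotient_pi subI 1) (\sum_(p <- t) p.1 *: p.2) =
      \sum_(p <- t) tens (quotient_pi subI 1) (p.1 *: p.2).
    by elim: t => [|p t IH]; rewrite ?big_nil ?tens0r // !big_cons tensDr IH.
  rewrite tens_sum big_seq; apply: big1 => p /Is Ip.
  rewrite tensZr -tensZl -quotient_piZ -[RHS](tens0l _ p.2); congr tens.
  by apply/quotient_pi0; rewrite /GRing.scale /= mulr1.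
(* the bilinear map inducing R/(I : y) (x) N -> N/(I : y)N *)
pose b (u : RJ) (n : N) := quotient_pi subJN (quotient_repr u *: n).
have bE a n : b (quotient_pi subJ a) n = quotient_pi subJN (a *: n).
  by apply/quotient_piP; rewrite -scalerBl; apply: smul_mem.
have b_bilin : Defs.bilinear b.
  split=> [u v n|u n n'|a u n|a u n]; rewrite -[u]quotient_reprK.
  - rewrite -[v]quotient_reprK -quotient_piD !bE -quotient_piD.
    by rewrite -scalerDl.
  - by rewrite !bE -quotient_piD scalerDr.
  - by rewrite -quotient_piZ !bE -quotient_piZ scalerA.
  - by rewrite !bE -quotient_piZ !scalerA mulrC.
move/(congr1 (tens_lift b)); rewrite tens_liftE // bE scale1r.
have -> : tens_lift b 0 = 0 by rewrite [LHS](tens_lift_class b_bilin) big_nil.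
by move/quotient_pi0.
Qed.
End Colon.

(** The isomorphism M (x) R -> M, x (x) a |-> a x, is natural in M. *)
Lemma flat_idfun (R : comNzRingType) : flat_map (idfun : {rmorphism R -> R}).
Proof.
move=> M M' u u_inj.
pose N := restrict_scalars (idfun : {rmorphism R -> R}).
pose act (P : lmodType R) (x : P) (a : N) : P := (a : R) *: x.
have act_bilin (P : lmodType R) : Defs.bilinear (@act P).
  split=> [x x' a|x a a'|c x a|c x a]; rewrite /act.
  - exact: scalerDr.
  - exact: scalerDl.
  - by rewrite !scalerA mulrC.
  - by rewrite scalerA.
have actK (P : lmodType R) (t : tensor P N) :
    t = tens (tens_lift (@act P) t) ((1 : R) : N).
  have [s ->] := tensor_sum t.
  rewrite -tens_classE tens_lift_class // tens_classE.
  elim: s => [|[x a] s IH]; first by rewrite !big_nil tens0l.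
  rewrite !big_cons tensDl -IH; congr (_ + _); rewrite /act /=.
  by rewrite tensZl -tensZr; congr tens; rewrite restr_scaleE mulr1.
have act_map t :
    tens_lift (@act M') (tensor_map u t) = u (tens_lift (@act M) t).
  have [s ->] := tensor_sum t; rewrite linear_sum -tens_classE.
  under eq_bigr do rewrite /= tensor_mapE.
  have -> : \sum_(p <- s) tens (u p.1) p.2 =
    tens_class [seq (u p.1, p.2) | p <- s] by rewrite tens_classE big_map.
  rewrite !tens_lift_class // big_map linear_sum.
  by apply: eq_bigr => p _; rewrite /act linearZ.
move=> t t' /(congr1 (tens_lift (@act M'))); rewrite !act_map => /u_inj tt'.
by rewrite (actK _ t) tt' -actK.
Qed.

(** * Modules over a field *)

(** By Zorn, there is a largest [W] meeting [U] only in 0. If z were not in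
    U + W, then W + F z would still meet [U] only in 0: a relation
    u = w + a z with a <> 0 can be solved for z. *)
Lemma submodule_complement (F : fieldType) (M : lmodType F) (U : set M) :
  is_submodule U ->
  exists W, [/\ is_submodule W, forall x, U x -> W x -> x = 0 &
    forall z, exists x w, [/\ U x, W w & z = x + w]].
Proof.
move=> [U0 UD UZ].
(* [0 \in W] is left out so that the empty union satisfies [P]; it follows from
   maximality. *)
pose P (W : set M) := [/\ forall x y, W x -> W y -> W (x + y),
  forall (a : F) x, W x -> W (a *: x) & forall x, U x -> W x -> x = 0].
have [|W [[WD WZ UW] Wmax]] := @Zorn_bigcup M P.
  move=> C CP totC.
  split=> [x y [X CX Xx] [Y CY Yy]|a x [X CX Xx]|x Ux [X CX Xx]].
  - have [XY|YX] := totC _ _ CX CY; [exists Y => // | exists X => //].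
      by have [D _ _] := CP _ CY; apply: D => //; apply: XY.
    by have [D _ _] := CP _ CX; apply: D => //; apply: YX.
  - by exists X => //; have [_ Z _] := CP _ CX; apply: Z.
  - by have [_ _] := CP _ CX; apply.
have maxE B : W `<=` B -> P B -> B `<=` W.
  move=> WB PB; apply: contrapT => BW; exact: (Wmax B).
have W0 : W 0.
  apply: (maxE (W `|` [set 0])); [by left| |by right].
  split=> [x y [Wx|->] [Wy|->]|a x [Wx|->]|x Ux [Wx|//]].
  - by left; apply: WD.
  - by rewrite addr0; left.
  - by rewrite add0r; left.
  - by rewrite addr0; right.
  - by left; apply: WZ.
  - by rewrite scaler0; right.
  - exact: UW.
exists W; split=> // z; apply: contrapT => Nz.
pose B : set M := [set y | exists w a, W w /\ y = w + a *: z].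
apply: (Nz); exists 0, z; split=> //; last by rewrite add0r.
apply: (maxE B); last by exists 0, 1; rewrite add0r scale1r.
  by move=> w Ww; exists w, 0; rewrite scale0r addr0.
split=> [_ _ [w [a [Ww ->]]] [w' [a' [Ww' ->]]]|c _ [w [a [Ww ->]]]|].
- by exists (w + w'), (a + a'); rewrite scalerDl addrACA; split=> //; apply: WD.
- by exists (c *: w), (c * a); rewrite scalerDr scalerA; split=> //; apply: WZ.
- move=> x Ux [w [a [Ww xE]]].
  have [a0|a0] := eqVneq a 0.
    by apply: UW => //; rewrite xE a0 scale0r addr0.
  case: Nz; exists (a^-1 *: x), (a^-1 *: - w); split; [exact: UZ| |].
    by rewrite -scaleN1r scalerA; apply: WZ.
  by rewrite -scalerDr xE addrC addKr scalerA mulVf // scale1r.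
Qed.

Lemma injective_retraction (F : fieldType) (M M' : lmodType F)
    (u : {linear M -> M'}) :
  injective u -> exists v : {linear M' -> M}, cancel u v.
Proof.
move=> u_inj; pose U : set M' := range u.
have subU : is_submodule U.
  split=> [|_ _ [x _ <-] [y _ <-]|a _ [x _ <-]].
  - by exists 0; rewrite ?linear0.
  - by exists (x + y); rewrite ?linearD.
  - by exists (a *: x); rewrite ?linearZ.
have [W [[W0 WD WZ] UW UWT]] := submodule_complement subU.
have decomp z : exists x, W (z - u x).
  by have [_ [w [[x _ <-] Ww ->]]] := UWT z; exists x; rewrite addrC addKr.
pose v z := projT1 (cid (decomp z)).
have vP z x : W (z - u x) -> v z = x.
  rewrite /v; case: cid => y /= Wy Wx; apply/u_inj/eqP.
  rewrite -subr_eq0; apply/eqP.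
  apply: UW; first by exists (y - x); rewrite ?linearB.
  have -> : u y - u x = (z - u x) + (-1) *: (z - u y).
    by rewrite scaleN1r opprB [RHS]addrC addrA subrK.
  by apply: WD => //; apply: WZ.
have v_linear : linear v.
  move=> a z z'; apply: vP; rewrite linearP.
  have -> : a *: z + z' - (a *: u (v z) + u (v z')) =
            a *: (z - u (v z)) + (z' - u (v z')).
    by rewrite scalerBr opprD addrACA.
  by apply: WD; [apply: WZ|]; rewrite /v; case: cid.
pose v_lin : {linear M' -> M} :=
  HB.pack v (GRing.isLinear.Build F M' M *:%R v v_linear).
by exists v_lin => x; apply: vP; rewrite subrr.
Qed.

Lemma flat_field (F : fieldType) (N : lmodType F) : flat N.
Proof.
move=> M M' u u_inj; have [v uK] := injective_retraction u_inj.
apply: (can_inj (g := tensor_map v)) => t; have [s ->] := tensor_sum t.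
rewrite (linear_sum (tensor_map u)) (linear_sum (tensor_map v)).
apply: eq_bigr => p _.
by rewrite /= tensor_mapE [LHS]tensor_mapE uK.
Qed.

(** * Finite rings and finite generation *)
Lemma finite_noetherian (R : comNzRingType) :
  finite_set [set: R] -> noetherian R.
Proof.
move=> finR I [I0 ID IZ].
have /finite_seqP[s sE] : finite_set I by apply: sub_finite_set finR.
exists (size s), (fun i => s`_i); apply/seteqP; split=> [x Ix|_ [c ->]].
  have xs : x \in s by have : [set` s] x by rewrite -sE.
  have xi : (index x s < size s)%N by rewrite index_mem.
  exists (fun i => (i == Ordinal xi)%:R).
  rewrite (bigD1 (Ordinal xi)) //= eqxx mul1r nth_index // big1 ?addr0 //.
  by move=> i /negPf ->; rewrite mul0r.
apply: big_ind => // i _; apply: IZ; rewrite sE; exact: mem_nth.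
Qed.

(** The proof of characteristic 2 is an argument so that the morphism structure
    can be inferred. *)
Definition of_F2 (R : comNzRingType) of 2%N \in [pchar R] : 'F_2 -> R :=
  fun a => (val a)%:R.

Lemma of_F2_zmod_morphism (R : comNzRingType) (ch2 : 2%N \in [pchar R]) :
  zmod_morphism (of_F2 ch2).
Proof.
move=> a b; rewrite /of_F2 (GRing.subr_pchar2 ch2) -natrD.
rewrite -(GRing.natr_mod_pchar ch2 (_ + _)).
by case: a => [[|[|?]] ?] //; case: b => [[|[|?]] ?].
Qed.

Lemma of_F2_monoid_morphism (R : comNzRingType) (ch2 : 2%N \in [pchar R]) :
  monoid_morphism (of_F2 ch2).
Proof.
split=> // a b; rewrite /of_F2 -natrM -(GRing.natr_mod_pchar ch2 (_ * _)).
by case: a => [[|[|?]] ?] //; case: b => [[|[|?]] ?].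
Qed.

HB.instance Definition _ (R : comNzRingType) (ch2 : 2%N \in [pchar R]) :=
  GRing.isZmodMorphism.Build _ _ (of_F2 ch2) (of_F2_zmod_morphism ch2).
HB.instance Definition _ (R : comNzRingType) (ch2 : 2%N \in [pchar R]) :=
  GRing.isMonoidMorphism.Build _ _ (of_F2 ch2) (of_F2_monoid_morphism ch2).

Lemma pchar2_flat_over_noetherian (R : comNzRingType) :
  2%N \in [pchar R] -> flat_over_noetherian R.
Proof.
move=> ch2; exists 'F_2, (of_F2 ch2); split; last exact: flat_field.
exact/finite_noetherian/finite_finset.
Qed.

Lemma is_ideal_gen (R : comNzRingType) n (g : 'I_n -> R) :
  is_ideal (ideal_gen g).
Proof.
split=> [|_ _ [c ->] [d ->]|a _ [c ->]].
- by exists (fun=> 0); rewrite big1 // => i _; rewrite mul0r.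
- exists (fun i => c i + d i); rewrite -big_split.
  by apply: eq_bigr => i _; rewrite mulrDl.
- exists (fun i => a * c i); rewrite mulr_sumr.
  by apply: eq_bigr => i _; rewrite mulrA.
Qed.

Lemma ideal_gen_mem (R : comNzRingType) n (g : 'I_n -> R) i : ideal_gen g (g i).
Proof.
exists (fun j => (j == i)%:R); rewrite (bigD1 i) //= eqxx mul1r big1 ?addr0 //.
by move=> j /negPf ->; rewrite mul0r.
Qed.

Lemma ideal_gen_min (R : comNzRingType) n (g : 'I_n -> R) (I : set R) :
  is_ideal I -> (forall i, I (g i)) -> ideal_gen g `<=` I.
Proof.
by move=> [I0 ID IZ] Ig _ [c ->]; apply: big_ind => // i _; apply: IZ.
Qed.

Lemma card_finType (T : finType) : [set: T] #= `I_#|T|.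
Proof.
have -> : [set: T] = enum_val @` [set: 'I_#|T|].
  by apply/seteqP; split=> // x _; exists (enum_rank x); rewrite ?enum_rankK.
apply: card_eq_trans (card_esym card_II).
by apply: inj_card_eq => i j _ _; apply: enum_val_inj.
Qed.

(** A relation in which the coefficient of one generator is a unit expresses
    that generator through the others. *)
Lemma drop_generator (R : comNzRingType) n (g d : 'I_n.+1 -> R)
    (j : 'I_n.+1) e :
  e * d j = 1 -> \sum_i d i * g i = 0 ->
  ideal_gen g = ideal_gen (fun i => g (lift j i)).
Proof.
move=> dj1 rel; have idl := is_ideal_gen (fun i => g (lift j i)).
apply/seteqP; split; apply: ideal_gen_min; try exact: is_ideal_gen; last first.
  by move=> i; apply: ideal_gen_mem.
move=> i; case: (unliftP j i) => [k ->|->].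
  exact: (ideal_gen_mem (fun i => g (lift j i))).
exists (fun k => - (e * d (lift j k))).
move/(congr1 ( *%R e)): rel; rewrite mulr0 (bigD1_ord j) //=.
rewrite mulrDr mulrA dj1 mul1r.
move/eqP; rewrite addr_eq0 => /eqP ->; rewrite mulr_sumr -sumrN.
by apply: eq_bigr => k _; rewrite mulNr mulrA.
Qed.

(** * Square zero extensions of F_2 *)

Section SquareZero.
Variables (R : comNzRingType) (m : set R).
Hypothesis hm : square_zero_ext_F2 m.

Let m_ideal : is_ideal m. Proof. by case: hm. Qed.

Lemma mul_sqz x y : m x -> m y -> x * y = 0.
Proof.
have [_ _ m2] := hm; move=> mx my; suff : [set 0] (x * y) by [].
rewrite -m2; exists 1%N, (fun=> x), (fun=> y); split=> //.
by rewrite big_ord1.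
Qed.

(** If 1 were in [m] there would be a single coset, so the two cosets are those
    of 0 and 1. *)
Lemma sqz_residue : ~ m 1 /\ forall r, m r \/ m (r - 1).
Proof.
have [[m0 mD mZ] m2 _] := hm.
have mN x : m x -> m (- x) by rewrite -mulN1r; apply: mZ.
pose coset x : set R := [set y | m (y - x)].
have cosetP x y : coset x = coset y <-> m (x - y).
  split=> [xy|mxy].
    by rewrite -[m _]/(coset y x) -xy /coset /= subrr.
  apply/seteqP; split=> t; rewrite /coset /= => mt.
    by rewrite -(subrKA x); apply: mD.
  by rewrite -(subrKA y) -(opprB x y); apply: mD => //; apply: mN.
have [_ [a _ <-] /eq_cardSP[_ [[b _ <-] /= ba]]] := eq_cardSP _ _ m2.
rewrite II0 card_eq0 => /eqP rest.
have two x : coset x = coset a \/ coset x = coset b.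
  apply: contrapT => /not_orP[xa xb].
  suff : set0 (coset x) by [].
  by rewrite -rest; split; [split; [exists x|exact: xa]|exact: xb].
have not_m1 : ~ m 1.
  by move=> m1; apply: ba; apply/cosetP; rewrite -[_ - _]mulr1; apply: mZ.
have n01 : coset 0 <> coset 1.
  by move/cosetP; rewrite sub0r => /mN; rewrite opprK.
split=> // r.
suff [/cosetP|/cosetP] : coset r = coset 0 \/ coset r = coset 1.
- by rewrite subr0; left.
- by right.
have := (two r, two 0, two 1).
by case=> -[[rE|rE] [zE|zE]] [oE|oE]; try (by left; congruence);
  right; congruence.
Qed.

(** 2 lies in m, since 2 - 1 does not. *)
Lemma sqz_double x : m x -> x + x = 0.
Proof.
have [m1 dich] := sqz_residue; have [_ mD _] := m_ideal.
move=> mx; have m2 : m 2.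
  have [//|] := dich 2; have -> : 2 - 1 = 1 :> R by rewrite -[2]/(1 + 1) addrK.
  by [].
by rewrite -mulr2n -mulr_natl; apply: mul_sqz.
Qed.

(** (1 + x)^2 = 1 + 2 x + x^2 for x in m. *)
Lemma sqz_involution r : ~ m r -> r * r = 1.
Proof.
have [m1 dich] := sqz_residue; have [//|mr1 _] := dich r.
rewrite -[r](subrK 1) mulrDl mulrDr mul1r mulr1 (mul_sqz mr1 mr1) add0r.
by rewrite addrA sqz_double // add0r.
Qed.

(** [m] is a vector space over the residue field: a scalar acts through its
    residue class, 0 or 1. *)
Lemma sqz_scale r x : m x -> r * x = (`[< ~ m r >])%:R * x.
Proof.
move=> mx; have [m1 dich] := sqz_residue.
case: asboolP => [|/contrapT mr]; last by rewrite mul0r mul_sqz.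
have [//|mr1 _] := dich r.
by rewrite -[r](subrK 1) mulrDl (mul_sqz mr1 mx) add0r.
Qed.

Definition sqz_param n (g : 'I_n -> R) (p : bool * {ffun 'I_n -> bool}) : R :=
  p.1%:R + \sum_i (p.2 i)%:R * g i.

Lemma sqz_param_surj n (g : 'I_n -> R) : m = ideal_gen g ->
  range (sqz_param g) = [set: R].
Proof.
move=> mE; apply/seteqP; split=> // r _.
have mg i : m (g i) by rewrite mE; apply: ideal_gen_mem.
have [b mrb] : exists b : bool, m (r - b%:R).
  have [_ dich] := sqz_residue.
  by have [mr|mr] := dich r; [exists false; rewrite subr0|exists true].
have [c cE] : ideal_gen g (r - b%:R) by rewrite -mE.
exists (b, [ffun i => `[< ~ m (c i) >]]) => //.
rewrite /sqz_param /= -[r](subrK b%:R) cE addrC; congr (_ + _).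
by apply: eq_bigr => i _; rewrite ffunE -sqz_scale.
Qed.

Lemma sqz_fg_finite n (g : 'I_n -> R) : m = ideal_gen g -> finite_set [set: R].
Proof.
by move=> mE; rewrite -(sqz_param_surj mE); exact/finite_image/finite_finset.
Qed.

Lemma sqz_noetherian_finite : noetherian R -> finite_set [set: R].
Proof. by move=> noeR; have [n [g /sqz_fg_finite]] := noeR _ m_ideal. Qed.

(** The coefficient [b] is the residue class of the value, hence is determined.
    If two families of coefficients in {0, 1} differ at [j], their difference is
    1 or -1 there, so the relation they give makes the generator [g j]
    redundant. *)
Lemma sqz_param_inj n (g : 'I_n -> R) : m = ideal_gen g ->
  (forall k (h : 'I_k -> R), m = ideal_gen h -> (n <= k)%N) ->
  injective (sqz_param g).
Proof.
move=> mE n_min [b c] [b' c'] eq_bc; have [m1 _] := sqz_residue.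
have [m0 mD mZ] := m_ideal.
have mg i : m (g i) by rewrite mE; apply: ideal_gen_mem.
have bE p : p.1 = `[< ~ m (sqz_param g p) >].
  have mp : m (\sum_i (p.2 i)%:R * g i).
    by apply: big_ind => // i _; apply: mZ.
  case: p mp => -[] d /= mp; rewrite /sqz_param /=; apply/esym.
    apply/asboolP => m1p; apply: m1.
    rewrite -(addrK (\sum_i (d i)%:R * g i) 1) -mulN1r.
    by apply: mD => //; apply: mZ.
  by apply/asboolP; rewrite add0r.
have bb' : b = b' by have := bE (b, c); rewrite eq_bc -bE.
rewrite -bb' in eq_bc *; congr pair; apply/ffunP => j; apply: contrapT => cj.
case: n g n_min mE mg c c' j eq_bc bE cj {bb'} => [|n] g n_min mE mg c c' j.
  by case: j.
move=> /addrI eq_c _ cj.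
pose d i : R := (c i)%:R - (c' i)%:R.
have dj : d j * d j = 1.
  rewrite /d; case: (c j) (c' j) cj => -[] //= _; first by rewrite subr0 mulr1.
  by rewrite sub0r mulrNN mulr1.
have rel : \sum_i d i * g i = 0.
  under eq_bigr do rewrite mulrBl.
  by rewrite sumrB eq_c subrr.
by have := n_min _ _ (etrans mE (drop_generator dj rel)); rewrite ltnn.
Qed.

Lemma sqz_card : finite_set [set: R] ->
  exists n, mu_ideal m n /\ [set: R] #= `I_(2 ^ n.+1).
Proof.
move=> /finite_noetherian noeR.
have fg : exists n, `[< exists g : 'I_n -> R, m = ideal_gen g >].
  by have [n mg] := noeR _ m_ideal; exists n; apply/asboolP.
case: (ex_minnP fg) => n /asboolP[g mE] n_min.
have {}n_min k (h : 'I_k -> R) : m = ideal_gen h -> (n <= k)%N.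
  by move=> mh; apply: n_min; apply/asboolP; exists h.
exists n; split; first by split=> //; exists g.
rewrite -(sqz_param_surj mE) expnS.
have -> : (2 * 2 ^ n = #|{: bool * {ffun 'I_n -> bool}}|)%N.
  by rewrite card_prod card_ffun card_bool card_ord.
apply: card_eq_trans (card_finType _).
by apply: inj_card_eq => p q _ _; apply: sqz_param_inj.
Qed.

End SquareZero.

(** * Flat maps to and from Noetherian rings *)

(** A S is an ideal of S, hence has finitely many generators, and each of them
    involves only finitely many elements of [A]. *)
Lemma noetherian_smul_fg (R S : comNzRingType) (f : {rmorphism R -> S})
    (A : set R) :
  noetherian S -> exists t : seq R, {in t, forall a, A a} /\
    smul A (restrict_scalars f) `<=` smul [set` t] (restrict_scalars f).
Proof.
move=> noeS; pose N := restrict_scalars f.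
have smul_ideal B : is_ideal (smul B N : set S).
  have [B0 BD _] := smul_submodule N B; split=> // a _ [s [Bs ->]].
  exists [seq (p.1, (a * p.2 : S)) | p <- s].
  split=> [_ /mapP[p /Bs Bp ->] //|].
  rewrite big_map mulr_sumr; apply: eq_bigr => p _.
  by rewrite !restr_scaleE mulrCA.
have [n [h hE]] := noeS _ (smul_ideal A).
have hA i : exists s : seq (R * N), {in s, forall p, A p.1} /\
    h i = \sum_(p <- s) p.1 *: p.2.
  have := ideal_gen_mem h i; rewrite -hE => -[s [As hs]]; by exists s.
have [s sP] := choice hA.
exists (flatten [seq [seq p.1 | p <- s i] | i <- enum 'I_n]).
split=> [a /flattenP[_ /mapP[i _ ->] /mapP[p ps ->]]|].
  by have [As _] := sP i; apply: As.
rewrite [X in X `<=` _]hE; apply: ideal_gen_min => // i.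
have [As ->] := sP i; exists (s i); split=> // p ps /=.
apply/flattenP; exists [seq p.1 | p <- s i].
  by apply: map_f; rewrite mem_enum.
exact: map_f.
Qed.

(** Faithful flatness in disguise: [I], generated by finitely many elements of
    [m] with I S = m S, must be all of [m], or else 1 would lie in m S. *)
Lemma sqz_flat_to_noetherian (R : comNzRingType) (m : set R) :
  square_zero_ext_F2 m -> flat_to_noetherian R -> noetherian R.
Proof.
move=> hm [S [f [noeS flatS]]]; have [m_ideal _ _] := hm.
have [m1 dich] := sqz_residue hm.
have [t [tm fgt]] := noetherian_smul_fg f m noeS.
pose I := ideal_gen (fun i : 'I_(size t) => t`_i).
have idI : is_ideal I by exact: is_ideal_gen.
have tI : [set` t] `<=` I.
  move=> a /= ta; have ai : (index a t < size t)%N by rewrite index_mem.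
  have := ideal_gen_mem (fun i : 'I_(size t) => t`_i) (Ordinal ai).
  by rewrite /= nth_index.
suff mI : m = I by exact: finite_noetherian (sqz_fg_finite hm mI).
apply/seteqP; split; last first.
  by apply: ideal_gen_min => // i; apply: tm; apply: mem_nth.
move=> y my; apply: contrapT => Iy.
have colon_m : colon I y `<=` m.
  move=> a Iay; apply: contrapT => ma; apply: Iy.
  by rewrite -[y]mul1r -(sqz_involution hm ma) -mulrA; case: idI => _ _; apply.
(* y 1 lies in m S = I S *)
have : smul m (restrict_scalars f) (1 : S).
  apply: (smulS colon_m); apply: flat_colon => //; apply: (smulS tI).
  exact/fgt/smul_mem.
move=> [s [ms /= one]].
(* (m S)^2 = 0 *)
have : (1 : S) * 1 = 0.
  rewrite {1}one mulr_suml big_seq big1 // => p /ms mp.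
  rewrite restr_scaleE mulrAC one mulr_sumr.
  rewrite big_seq big1 ?mul0r // => q /ms mq.
  by rewrite restr_scaleE mulrA -rmorphM (mul_sqz hm) // rmorph0 mul0r.
by rewrite mulr1 => /eqP; rewrite oner_eq0.
Qed.

(** The preimage of [m] in [S] generates [m] in [R]: for x in m, flatness turns
    2 x = 0 into x in Ann_S(2) R, and Ann_S(2) maps into [m] because its image
    kills 2 <> 0, which no unit does. *)
Lemma sqz_flat_over_noetherian (R : comNzRingType) (m : set R) :
  square_zero_ext_F2 m -> 2 != 0 :> R -> flat_over_noetherian R -> noetherian R.
Proof.
move=> hm two0 [S [f [noeS flatR]]]; have [m_ideal _ _] := hm.
have [m0 mD mZ] := m_ideal.
have idp : is_ideal (f @^-1` m).
  split=> [|a b|a b] /=; first by rewrite rmorph0.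
    by rewrite rmorphD; apply: mD.
  by rewrite rmorphM; apply: mZ.
have [n [g pE]] := noeS _ idp.
suff mE : m = ideal_gen (f \o g).
  exact: finite_noetherian (sqz_fg_finite hm mE).
apply/seteqP; split; last first.
  by apply: ideal_gen_min => // i; have := ideal_gen_mem g i; rewrite -pE.
move=> x mx.
have id0 : is_ideal [set (0 : S)].
  by split=> // [a b -> ->|a b ->]; rewrite ?addr0 ?mulr0.
have sub : smul (colon [set 0] 2) (restrict_scalars f) `<=` ideal_gen (f \o g).
  have [I0 ID IZ] := is_ideal_gen (f \o g).
  apply: smul_min => [|a x' a2].
    by split=> // c z Iz; rewrite restr_scaleE; apply: IZ.
  rewrite restr_scaleE mulrC; apply: IZ.
  have : ideal_gen g a.
    rewrite -pE /=; apply: contrapT => /(sqz_involution hm) fa.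
    have fa2 : f a * 2 = 0 by rewrite -(rmorph_nat f 2) -rmorphM a2 rmorph0.
    by case/eqP: two0; rewrite -[LHS]mul1r -{1}fa -mulrA fa2 mulr0.
  move=> [c ->]; exists (f \o c); rewrite rmorph_sum.
  by apply: eq_bigr => i _; rewrite rmorphM.
apply: sub.
apply: flat_colon => //.
suff -> : (2 : S) *: (x : restrict_scalars f) = 0.
  by have [] := smul_submodule (restrict_scalars f) [set 0].
by rewrite restr_scaleE rmorph_nat mulr_natl mulr2n (sqz_double hm).
Qed.

Lemma noetherian_flat_over_noetherian (R : comNzRingType) :
  noetherian R -> flat_over_noetherian R.
Proof. by move=> noeR; exists R, idfun; split=> //; apply: flat_idfun. Qed.

Lemma noetherian_flat_to_noetherian (R : comNzRingType) :
  noetherian R -> flat_to_noetherian R.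
Proof. by move=> noeR; exists R, idfun; split=> //; apply: flat_idfun. Qed.

Theorem theorem12 (R : comNzRingType) (m : set R)
    (hm : square_zero_ext_F2 m) :
  ((flat_to_noetherian R <-> noetherian R) /\
   (noetherian R <-> finite_set [set: R]) /\
   (finite_set [set: R] ->
      exists n : nat, mu_ideal m n /\ [set: R] #= `I_(2 ^ n.+1))) /\
  (flat_over_noetherian R <-> 2%N \in [pchar R] \/ noetherian R).
Proof.
split; last first.
  split=> [flatR|[]]; last exact: noetherian_flat_over_noetherian.
    have [two0|two0] := eqVneq (2 : R) 0; last first.
      by right; apply: sqz_flat_over_noetherian hm two0 flatR.
    by left; rewrite inE /= two0 eqxx.
  exact: pchar2_flat_over_noetherian.
split; first split.
- exact: sqz_flat_to_noetherian hm.
- exact: noetherian_flat_to_noetherian.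
split; last exact: sqz_card hm.
by split; [exact: sqz_noetherian_finite hm | exact: finite_noetherian].
Qed.
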